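(* Let $\mathcal{A}\subseteq\mathbb{R}^k$ be a finite nonempty set, $C>0$, $q\ge1$, and $d$ a metric on $\mathbb{R}^k$. In each of the following two cases one has $\mathcal{Z}_C^*<\mathcal{Z}^*$: (i) $\operatorname{diam}(\mathcal{A})>2C$, $q=1$ and $d$ is an arbitrary metric; (ii) $\operatorname{diam}(\mathcal{A})>2\sqrt[q]{C}$, $q>1$ and $d$ is derived from an $\ell_p$-norm, $p\in[1,\infty]$.
   Context: $d^q(x,y)=(d(x,y))^q$ and $\operatorname{diam}(\mathcal{A})=\max_{a_1,a_2\in\mathcal{A}} d(a_1,a_2)$. The optimal values are $\mathcal{Z}^*=\min_{x\in\mathbb{R}^k}\sum_{a\in\mathcal{A}} d^q(x,a)$ and $\mathcal{Z}_C^*=\min_{x\in\mathbb{R}^k}\sum_{a\in\mathcal{A}}\min\{d^q(x,a),C\}$; the minima are understood to be attained (automatic if $d$ is derived from a norm). *)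

(* Defs.v *)
From HB Require Import structures.
From mathcomp Require Import all_boot all_order all_algebra finmap.
From mathcomp Require Import all_classical all_reals all_analysis.
Set Implicit Arguments.
Unset Strict Implicit.
Unset Printing Implicit Defensive.
Import Order.TTheory GRing.Theory Num.Theory.
Local Open Scope ring_scope.

(* The library's metricType attaches a metric to the carrier as its canonical
   topological structure; here the metric on R^k is arbitrary, hence a
   predicate. *)
Record is_metric (R : realType) (T : Type) (d : T -> T -> R) : Prop := IsMetric {
  metric_ge0 : forall x y, 0 <= d x y ;
  metric_eq0 : forall x y, d x y = 0 <-> x = y ;
  metric_sym : forall x y, d x y = d y x ;
  metric_triangle : forall x y z, d x z <= d x y + d y z }.

(* The value at -oo is junk: the norm is only used for 1 <= p. *)
Definition lp_norm (R : realType) (k : nat) (p : \bar R) (x : 'rV[R]_k) : R :=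
  match p with
  | EFin r => (\sum_(i < k) `|x 0 i| `^ r) `^ r^-1
  | +oo%E => \big[Num.max/0]_(i < k) `|x 0 i|
  | -oo%E => 0
  end.

Definition lp_derived (R : realType) (k : nat)
    (d : 'rV[R]_k -> 'rV[R]_k -> R) : Prop :=
  exists2 p : \bar R, (1 <= p)%E & forall x y, d x y = lp_norm p (x - y).

(* The default value 0 of the maxima is harmless, distances being
   nonnegative. *)
Definition diam (R : realType) (T : choiceType) (d : T -> T -> R)
    (A : {fset T}) : R :=
  \big[Num.max/0]_(a <- A) \big[Num.max/0]_(b <- A) d a b.

Definition objective (R : realType) (T : choiceType) (d : T -> T -> R)
    (q : R) (A : {fset T}) (x : T) : R :=
  \sum_(a <- A) d x a `^ q.

Definition trunc_objective (R : realType) (T : choiceType) (d : T -> T -> R)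
    (q C : R) (A : {fset T}) (x : T) : R :=
  \sum_(a <- A) Num.min (d x a `^ q) C.

Definition is_minimum (R : realType) (T : Type) (f : T -> R) (m : R) : Prop :=
  (exists x, f x = m) /\ (forall y, m <= f y).

Definition has_minimum (R : realType) (T : Type) (f : T -> R) : Prop :=
  exists m, is_minimum f m.

(* A genuine minimum, not an infimum: a junk 0 when f does not attain its
   infimum. *)
Definition minimum (R : realType) (T : Type) (f : T -> R) : R :=
  xget 0 [set m | is_minimum f m]%classic.

Definition Zopt (R : realType) (T : choiceType) (d : T -> T -> R)
    (q : R) (A : {fset T}) : R :=
  minimum (objective d q A).

Definition Zopt_trunc (R : realType) (T : choiceType) (d : T -> T -> R)
    (q C : R) (A : {fset T}) : R :=
  minimum (trunc_objective d q C A).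

(* Main.v *)
(* If d x a ^ q <= C for all a in A, the triangle inequality through x gives
   diam A <= 2 C ^ (1/q). So under either hypothesis the truncated objective is
   strictly below the objective at every point x, in particular at a minimizer
   of the latter.

   In case (ii) both minima are attained: an l_p norm is equivalent to the sup
   norm, so both objectives are continuous; outside a large ball the objective
   exceeds its value at a point of A, and the truncated objective equals its
   upper bound #|A| C. *)
Require Import Defs.
From HB Require Import structures.
From mathcomp Require Import all_boot all_order all_algebra finmap.
From mathcomp Require Import all_classical all_reals all_analysis.
Set Implicit Arguments.
Unset Strict Implicit.
Unset Printing Implicit Defensive.
Import Order.TTheory GRing.Theory Num.Theory.
Import numFieldNormedType.Exports.
Local Open Scope ring_scope.

(** * Pointwise strict inequality, and its passage to minima *)

Lemma minimumP (R : realType) (T : Type) (f : T -> R) :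
  has_minimum f -> is_minimum f (minimum f).
Proof. by case=> m fm; rewrite /minimum; case: xgetP => // /(_ m). Qed.

Lemma diam_le (R : realType) (T : choiceType) (d : T -> T -> R)
    (A : {fset T}) (D : R) :
  0 <= D -> (forall a b, a \in A -> b \in A -> d a b <= D) -> diam d A <= D.
Proof.
move=> D_ge0 dD; rewrite /diam big_seq; apply: bigmax_le => // a aA.
by rewrite big_seq; apply: bigmax_le => // b bA; exact: dD.
Qed.

Lemma trunc_objective_lt (R : realType) (T : choiceType) (d : T -> T -> R)
    (A : {fset T}) (C q : R) (x : T) :
  is_metric d -> 0 < C -> 1 <= q -> 2 * C `^ q^-1 < diam d A ->
  trunc_objective d q C A x < objective d q A x.
Proof.
move=> dm C_gt0 q_ge1 diamC.
have q_gt0 : 0 < q := lt_le_trans ltr01 q_ge1.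
have [a aA Ca] : exists2 a, a \in A & C < d x a `^ q.
  apply: contrapT => /forall2NP near_all; move: diamC.
  apply/negP; rewrite -leNgt; apply: diam_le => [|a b aA bA].
    by rewrite mulr_ge0// powR_ge0.
  have dC c : c \in A -> d x c <= C `^ q^-1.
    move=> cA; have [//|/negP] := near_all c; rewrite -leNgt => xcC.
    have := ge0_ler_powR (ltW (_ : 0 < q^-1)) _ _ xcC.
    rewrite -powRrM divff ?gt_eqF// powRr1 ?(metric_ge0 dm)//.
    by apply; rewrite ?invr_gt0// nnegrE ?powR_ge0// ltW.
  rewrite mulr_natl mulr2n (le_trans (Defs.metric_triangle dm a x b))//.
  by rewrite lerD ?dC// (Defs.metric_sym dm) dC.
(* Truncation strictly lowers the term of the far point [a] and raises no other term. *)
rewrite /trunc_objective /objective [ltLHS](big_fsetD1 a)//.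
rewrite [ltRHS](big_fsetD1 a)//=.
apply: ltr_leD.
  by rewrite gt_min Ca orbT.
by apply: ler_sum => c _; rewrite ge_min lexx.
Qed.

(** Evaluate both functions at a minimizer of [g]. Attainment for [f] rules out the junk value of
    [minimum f]. *)
Lemma minimum_lt (R : realType) (T : Type) (f g : T -> R) :
  (forall x, f x < g x) -> has_minimum f -> has_minimum g ->
  minimum f < minimum g.
Proof.
move=> fg /minimumP[_ fmin] /minimumP[[x <-] _].
exact: le_lt_trans (fmin x) (fg x).
Qed.

(** * Sup-norm estimates and continuity on R^k *)

Section Lp.
Variables (R : realType) (k : nat).
Implicit Types (x : 'rV[R]_k) (p : \bar R).

Lemma coord_le_mx_norm x i : `|x 0 i| <= `|x|.
Proof.
rewrite [leRHS]mx_normrE.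
exact: (le_bigmax _ (fun ij => `|x ij.1 ij.2|) (0, i)).
Qed.

Lemma mx_norm_le x (r : R) : 0 <= r -> (forall i, `|x 0 i| <= r) -> `|x| <= r.
Proof.
move=> r_ge0 xr; rewrite [leLHS]mx_normrE; apply/bigmax_leP; split=> //.
by case=> i j _ /=; rewrite ord1.
Qed.

(** For finite [p], a single term of the sum already gives the coordinate. *)
Lemma mx_norm_le_lp_norm p x : (1 <= p)%E -> `|x| <= lp_norm p x.
Proof.
case: p => [r| |]//=; last first.
  move=> _; apply: mx_norm_le => [|i].
    exact: bigmax_ge_id.
  exact: le_bigmax.
rewrite lee_fin => r_ge1; have r_gt0 : 0 < r := lt_le_trans ltr01 r_ge1.
apply: mx_norm_le => [|i]; first exact: powR_ge0.
rewrite -[leLHS]powRr1// -(divff (lt0r_neq0 r_gt0)) powRrM.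
apply: ge0_ler_powR; rewrite ?invr_ge0 ?(ltW r_gt0) ?nnegrE ?powR_ge0//.
  by apply: sumr_ge0 => j _; exact: powR_ge0.
by rewrite (bigD1 i)//= lerDl sumr_ge0// => j _; exact: powR_ge0.
Qed.

(** For finite [p], each of the [k] terms is at most the corresponding power of the sup norm. The
    maximum with 1 serves the case [+oo] and keeps the constant positive when [k] is 0. *)
Lemma lp_norm_le_mx_norm p x : (1 <= p)%E ->
  lp_norm p x <= Num.max 1 (k%:R `^ (fine p)^-1) * `|x|.
Proof.
case: p => [r| |]//=; last first.
  move=> _; apply/bigmax_leP; split=> [|i _].
    by rewrite mulr_ge0// le_max ler01.
  rewrite (le_trans (coord_le_mx_norm x i))// ler_peMl// le_max lexx//.
rewrite lee_fin => r_ge1; have r_gt0 : 0 < r := lt_le_trans ltr01 r_ge1.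
rewrite (@le_trans _ _ (k%:R `^ r^-1 * `|x|))//; last first.
  by rewrite ler_wpM2r// le_max lexx orbT.
have -> : `|x| = (`|x| `^ r) `^ r^-1.
  by rewrite -powRrM divff ?gt_eqF// powRr1.
rewrite -powRM ?powR_ge0//.
have ge0r : 0 <= r^-1 by rewrite invr_ge0 ltW.
apply: (ge0_ler_powR ge0r); rewrite ?nnegrE ?mulr_ge0 ?powR_ge0//.
  by apply: sumr_ge0 => j _; exact: powR_ge0.
rewrite mulr_natl -[X in _ *+ X]card_ord -sumr_const; apply: ler_sum => i _.
by apply: ge0_ler_powR; rewrite ?(ltW r_gt0) ?nnegrE// coord_le_mx_norm.
Qed.

(** By the triangle inequality, [d x a] and [d y a] differ by at most [d x y], hence by at most [K]
    times the sup norm of [x - y]. *)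
Lemma lp_derived_continuous (d : 'rV[R]_k -> 'rV[R]_k -> R) (a : 'rV[R]_k) :
  is_metric d -> lp_derived d -> continuous (d^~ a).
Proof.
move=> dm [p p_ge1 dE] x.
set K := Num.max 1 (k%:R `^ (fine p)^-1).
have K_gt0 : 0 < K by rewrite lt_max ltr01.
apply/(@cvgrPdist_lt _ _ _ (nbhs x)) => e e_gt0.
have eK : 0 < e / K by rewrite divr_gt0.
have : \forall y \near nbhs x, `|x - y| < e / K.
  by apply/nbhs_ballP; exists (e / K) => //= y; rewrite mx_norm_ball.
apply: filterS => y; rewrite ltr_pdivlMr// mulrC => xy.
have dxy : d x y < e by rewrite dE (le_lt_trans (lp_norm_le_mx_norm _ p_ge1)).
rewrite ltr_norml; apply/andP; split.
  rewrite ltrBrDl ltrBlDr (le_lt_trans (Defs.metric_triangle dm y x a))//.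
  by rewrite addrC ltrD2l (Defs.metric_sym dm).
by rewrite ltrBlDr (le_lt_trans (Defs.metric_triangle dm x y a))// ltrD2r.
Qed.

(** The absolute value keeps the base nonnegative and changes nothing on distances. *)
Lemma continuous_norm_powR (q : R) : 0 < q ->
  continuous (fun t : R => `|t| `^ q).
Proof.
move=> q_gt0 t; have [->|t_neq0] := eqVneq t 0.
  apply/cvgrPdist_lt => e e_gt0; rewrite normr0 powR0 ?gt_eqF//.
  have e'_gt0 : 0 < e `^ q^-1 by exact: powR_gt0.
  have : \forall s \near nbhs (0 : R), `|s| < e `^ q^-1.
    apply/nbhs_ballP; exists (e `^ q^-1) => //= s.
    by rewrite /ball/= sub0r normrN.
  apply: filterS => s /(gt0_ltr_powR q_gt0).
  rewrite !nnegrE normr_ge0 powR_ge0 => /(_ isT isT).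
  rewrite -powRrM mulVf ?gt_eqF// powRr1 ?(ltW e_gt0)//.
  by rewrite sub0r normrN (ger0_norm (powR_ge0 _ _)).
apply: (@continuous_comp R R R Num.norm (@powR R ^~ q)).
  exact: norm_continuous.
apply: differentiable_continuous; apply/derivable1_diffP.
by apply: derivable_powR; rewrite in_itv/= andbT normr_gt0.
Qed.

Lemma continuous_sum_seq (T : topologicalType) (I : Type) (s : seq I)
    (F : I -> T -> R) :
  (forall i, continuous (F i)) -> continuous (fun y => \sum_(i <- s) F i y).
Proof.
move=> Fc; elim: s => [|i s IH] x.
  under eq_fun do rewrite big_nil; exact: cvg_cst.
by under eq_fun do rewrite big_cons; apply: continuousD; [exact: Fc|exact: IH].
Qed.

(* A minimizer on the ball of radius [max M |x0|] is global: it does at least as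
   well as [x0], which does at least as well as any point outside. *)
Lemma continuous_has_minimum (f : 'rV[R]_k -> R) (x0 : 'rV[R]_k) (M : R) :
  continuous f -> (forall x, M < `|x| -> f x0 <= f x) -> has_minimum f.
Proof.
move=> fc fM; pose r := Num.max M `|x0|.
pose B := [set x : 'rV[R]_k | `|x| <= r]%classic.
have Bx0 : B x0 by rewrite /B/= le_max lexx orbT.
have cB : compact B.
  apply: bounded_closed_compact.
    exists r; split; first exact: num_real.
    by move=> s rs x Bx; exact: le_trans Bx (ltW rs).
  apply: (@closed_comp _ R Num.norm [set s : R | s <= r]%classic).
    by move=> x _; exact: norm_continuous.
  exact: closed_le.
have [||c cBc cmin] := @EVT_min_rV R k f B _ cB.
- by exists x0.
- exact: continuous_subspaceT.
exists (f c); split; first by exists c.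
move=> x; have [xr|rx] := leP `|x| r; first by apply: cmin; rewrite inE.
apply: (@le_trans _ _ (f x0)); first by apply: cmin; rewrite inE.
by apply: fM; apply: le_lt_trans rx; rewrite le_max lexx.
Qed.

(** * Attainment of both minima for an l_p metric *)

Variables (d : 'rV[R]_k -> 'rV[R]_k -> R) (A : {fset 'rV[R]_k}) (q : R).
Hypotheses (dm : is_metric d) (dlp : lp_derived d) (q_gt0 : 0 < q).

Lemma lp_derived_ge (x a : 'rV[R]_k) : `|x| - `|a| <= d x a.
Proof.
case: dlp => p p_ge1 ->; apply: le_trans (mx_norm_le_lp_norm _ p_ge1).
exact: lerB_dist.
Qed.

Lemma powR_metric_continuous (a : 'rV[R]_k) : continuous (fun x => d x a `^ q).
Proof.
under eq_fun do rewrite -[d _ a]ger0_norm ?(metric_ge0 dm)//.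
move=> x; apply: (@continuous_comp _ _ _ (d^~ a) (fun t => `|t| `^ q)).
  exact: lp_derived_continuous.
exact: continuous_norm_powR.
Qed.

(** Coercivity with an explicit radius, applied below to a value of the objective and to [C]. *)
Lemma powR_metric_ge (x a : 'rV[R]_k) (v : R) : 0 <= v ->
  `|a| + v `^ q^-1 <= `|x| -> v <= d x a `^ q.
Proof.
move=> v_ge0 xv.
rewrite -[leLHS]powRr1// -(mulVf (lt0r_neq0 q_gt0)) powRrM.
apply: ge0_ler_powR; rewrite ?(ltW q_gt0) ?nnegrE ?powR_ge0 ?(metric_ge0 dm)//.
by apply: le_trans (lp_derived_ge x a); rewrite lerBrDl.
Qed.

Lemma objective_has_minimum : A != fset0 -> has_minimum (objective d q A).
Proof.
move=> /fset0Pn[a aA].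
have obj_ge0 x : 0 <= objective d q A x.
  by apply: sumr_ge0 => b _; exact: powR_ge0.
(* Beyond this radius the term of [a] alone reaches the value of the objective at [a]. *)
apply: (@continuous_has_minimum _ a (`|a| + objective d q A a `^ q^-1)).
  exact/continuous_sum_seq/powR_metric_continuous.
move=> x xM; apply: (le_trans (powR_metric_ge (obj_ge0 a) (ltW xM))).
rewrite /objective (big_fsetD1 a)//= lerDl sumr_ge0// => b _; exact: powR_ge0.
Qed.

Lemma trunc_objective_has_minimum (C : R) :
  0 < C -> has_minimum (trunc_objective d q C A).
Proof.
move=> C_gt0.
(* The sum of norms bounds each norm, so beyond this radius every truncated term equals [C], its
   largest possible value; the comparison point 0 is arbitrary. *)
apply: (@continuous_has_minimum _ 0 (\sum_(a <- A) `|a| + C `^ q^-1)).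
  apply: continuous_sum_seq => a x.
  apply: (@continuous_min _ _ (fun x => d x a `^ q) (fun=> C)).
    exact: powR_metric_continuous.
  exact: cst_continuous.
move=> x xM; rewrite /trunc_objective [leLHS]big_seq [leRHS]big_seq.
apply: ler_sum => a aA; rewrite [leRHS]min_r ?ge_min ?lexx ?orbT//.
apply: powR_metric_ge; first exact: ltW.
apply: le_trans (ltW xM); rewrite lerD2r (big_fsetD1 a)//= lerDl.
by rewrite sumr_ge0.
Qed.

End Lp.

Theorem theorem16 (R : realType) (k : nat) (A : {fset 'rV[R]_k}) (C q : R)
    (d : 'rV[R]_k -> 'rV[R]_k -> R)
    (A_neq0 : A != fset0) (C_gt0 : 0 < C) (q_ge1 : 1 <= q)
    (d_metric : is_metric d) :
  (2 * C < diam d A -> q = 1 ->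
   has_minimum (objective d q A) ->
   has_minimum (trunc_objective d q C A) ->
   Zopt_trunc d q C A < Zopt d q A) /\
  (2 * C `^ q^-1 < diam d A -> 1 < q -> lp_derived d ->
   Zopt_trunc d q C A < Zopt d q A).
Proof.
split=> [diamC q1 obj_min trunc_min|diamC q_gt1 dlp].
  apply: minimum_lt => // x; apply: trunc_objective_lt => //.
  by rewrite q1 invr1 powRr1 ?ltW.
have q_gt0 : 0 < q := lt_trans ltr01 q_gt1.
apply: minimum_lt => [x||]; first exact: trunc_objective_lt.
- exact: trunc_objective_has_minimum.
- exact: objective_has_minimum.
Qed.
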